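(* Let $K$ be a perfect field, $V_1,\dots,V_d$ finite-dimensional $K$-vector spaces, $V=V_1\otimes\cdots\otimes V_d$ and $\alpha\in\mathbb{R}^d_{>0}$. If $v\in V$ has (tensor) rank $1$, i.e. $v$ is nonzero and $v=v_1\otimes\cdots\otimes v_d$ with $v_i\in V_i$, then $$\operatorname{rk}^G_\alpha(v)=\min\{\alpha_1,\dots,\alpha_d\}.$$
   Context: $G$-stable rank: for a $K$-vector space $W$ and $v(t)\in K((t))\otimes W$, $\operatorname{val}_t(v(t))$ is the largest integer $m$ with $v(t)\in t^m(K[[t]]\otimes W)$, and $\operatorname{val}_t(0)=\infty$. Let $\mathrm{GL}(V_i,K[[t]])$ be the set of elements of $K[[t]]\otimes\operatorname{End}(V_i)$ that are invertible over $K((t))$ (the inverse need not have entries in $K[[t]]$), and $G(K[[t]])=\prod_i\mathrm{GL}(V_i,K[[t]])$, acting on $K((t))\otimes V$ factorwise. Then $\operatorname{rk}^G_\alpha(v)$ is the infimum of $$\mu_\alpha(g(t),v)=\frac{\sum_{i=1}^d\alpha_i\operatorname{val}_t(\det g_i(t))}{\operatorname{val}_t(g(t)\cdot v)}$$ over all $g(t)=(g_1(t),\dots,g_d(t))\in G(K[[t]])$ with $\operatorname{val}_t(g(t)\cdot v)>0$. *)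

(* Defs.v *)
From HB Require Import structures.
From mathcomp Require Import all_boot all_order all_algebra all_field.
From mathcomp Require Import all_classical all_reals ereal.
Set Implicit Arguments.
Unset Strict Implicit.
Unset Printing Implicit Defensive.
Import Order.TTheory GRing.Theory Num.Theory.
Local Open Scope ring_scope.

Definition perfect_field (K : fieldType) : Prop :=
  forall p : {poly K}, irreducible_poly p -> separable_poly p.

(** * The ring K[[t]] and the field K((t)) *)

Record powser (K : fieldType) := PowSer { pscoef : nat -> K }.

(* Equality and choice on [powser K] are classical. *)
HB.instance Definition _ (K : fieldType) := gen_eqMixin (powser K).
HB.instance Definition _ (K : fieldType) := gen_choiceMixin (powser K).

Definition ps_const (K : fieldType) (c : K) : powser K :=
  PowSer (fun n => if n == 0%N then c else 0).

Definition ps_add (K : fieldType) (a b : powser K) : powser K :=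
  PowSer (fun n => pscoef a n + pscoef b n).

Definition ps_opp (K : fieldType) (a : powser K) : powser K :=
  PowSer (fun n => - pscoef a n).

Definition ps_mul (K : fieldType) (a b : powser K) : powser K :=
  PowSer (fun n => \sum_(i < n.+1) pscoef a i * pscoef b (n - i)).

Lemma psP (K : fieldType) (a b : powser K) :
  (forall n, pscoef a n = pscoef b n) -> a = b.
Proof. by case: a b => [a] [b] /= H; congr PowSer; apply/funext. Qed.

Lemma ps_addA (K : fieldType) : associative (@ps_add K).
Proof. by move=> a b c; apply: psP => n /=; rewrite addrA. Qed.

Lemma ps_addC (K : fieldType) : commutative (@ps_add K).
Proof. by move=> a b; apply: psP => n /=; rewrite addrC. Qed.

Lemma ps_add0 (K : fieldType) : left_id (ps_const (0 : K)) (@ps_add K).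
Proof. by move=> a; apply: psP => n /=; rewrite if_same add0r. Qed.

Lemma ps_addN (K : fieldType) :
  left_inverse (ps_const (0 : K)) (@ps_opp K) (@ps_add K).
Proof. by move=> a; apply: psP => n /=; rewrite if_same addNr. Qed.

HB.instance Definition _ (K : fieldType) :=
  GRing.isZmodule.Build (powser K)
    (@ps_addA K) (@ps_addC K) (@ps_add0 K) (@ps_addN K).

(* The ring axioms are transferred from {poly K} by truncation. *)
Definition ps_trunc (K : fieldType) (N : nat) (a : powser K) : {poly K} :=
  \poly_(i < N) pscoef a i.

Lemma ps_mul_poly (K : fieldType) (a b : powser K) (p q : {poly K}) n :
  (forall i, (i <= n)%N -> p`_i = pscoef a i) ->
  (forall i, (i <= n)%N -> q`_i = pscoef b i) ->
  forall i, (i <= n)%N -> (p * q)`_i = pscoef (ps_mul a b) i.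
Proof.
move=> Hp Hq i le_in; rewrite coefM /=; apply: eq_bigr => j _.
have le_ji : (j <= i)%N by rewrite -ltnS.
rewrite Hp ?Hq //; first exact: leq_trans (leq_subr _ _) le_in.
exact: leq_trans le_ji le_in.
Qed.

Lemma ps_truncE (K : fieldType) (a : powser K) n i :
  (i <= n)%N -> (ps_trunc n.+1 a)`_i = pscoef a i.
Proof. by move=> le_in; rewrite coef_poly ltnS le_in. Qed.

Lemma ps_mulA (K : fieldType) : associative (@ps_mul K).
Proof.
move=> a b c; apply: psP => n.
pose T := ps_trunc n.+1.
have H x := @ps_truncE K x n.
rewrite -(ps_mul_poly (H a) (ps_mul_poly (H b) (H c)) (leqnn n)).
by rewrite -(ps_mul_poly (ps_mul_poly (H a) (H b)) (H c) (leqnn n)) mulrA.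
Qed.

Lemma ps_mulC (K : fieldType) : commutative (@ps_mul K).
Proof.
move=> a b; apply: psP => n.
have H x := @ps_truncE K x n.
rewrite -(ps_mul_poly (H a) (H b) (leqnn n)).
by rewrite -(ps_mul_poly (H b) (H a) (leqnn n)) mulrC.
Qed.

Lemma ps_mul1 (K : fieldType) : left_id (ps_const (1 : K)) (@ps_mul K).
Proof.
move=> a; apply: psP => n /=.
rewrite big_ord_recl /= mul1r subn0 big1 ?addr0 // => i _.
by rewrite mul0r.
Qed.

Lemma ps_mulDl (K : fieldType) : left_distributive (@ps_mul K) +%R.
Proof.
move=> a b c; apply: psP => n /=.
by rewrite -big_split /=; apply: eq_bigr => i _; rewrite mulrDl.
Qed.

Lemma ps_one_neq0 (K : fieldType) : ps_const (1 : K) != 0.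
Proof.
by apply/eqP => /(congr1 (fun a => pscoef a 0)) /= /eqP; rewrite oner_eq0.
Qed.

HB.instance Definition _ (K : fieldType) :=
  GRing.Zmodule_isComNzRing.Build (powser K)
    (@ps_mulA K) (@ps_mulC K) (@ps_mul1 K) (@ps_mulDl K) (@ps_one_neq0 K).

Definition ps_unit (K : fieldType) : {pred powser K} :=
  fun a => `[< exists b : powser K, b * a = 1 >].

Definition ps_inv (K : fieldType) (a : powser K) : powser K :=
  xget a [set b | b * a = 1]%classic.

Lemma ps_mulVx (K : fieldType) :
  {in @ps_unit K, left_inverse 1 (@ps_inv K) *%R}.
Proof.
move=> a /asboolP [b ba1]; rewrite /ps_inv; case: xgetP => [c _ //|].
by move=> /(_ b).
Qed.

Lemma ps_unitPl (K : fieldType) (a b : powser K) : b * a = 1 -> ps_unit a.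
Proof. by move=> ba1; apply/asboolP; exists b. Qed.

Lemma ps_inv_out (K : fieldType) : {in [predC @ps_unit K], @ps_inv K =1 id}.
Proof.
move=> a /asboolPn Ha; rewrite /ps_inv; case: xgetP => // b _ ba1.
by case: Ha; exists b.
Qed.

HB.instance Definition _ (K : fieldType) :=
  GRing.ComNzRing_hasMulInverse.Build (powser K)
    (@ps_mulVx K) (@ps_unitPl K) (@ps_inv_out K).

Lemma ps_neq0_order (K : fieldType) (a : powser K) : a != 0 ->
  exists m, pscoef a m != 0 /\ forall i, (i < m)%N -> pscoef a i = 0.
Proof.
move=> a0; have ex : exists n, pscoef a n != 0.
  apply: contrapT => H; case/eqP: a0; apply: psP => n /=; rewrite if_same.
  by apply/eqP; apply: contrapT => /negP an; apply: H; exists n.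
exists (ex_minn ex); case: ex_minnP => m am Hm; split=> // i lt_im.
by apply/eqP; apply: contraTT lt_im => /Hm; rewrite -leqNgt.
Qed.

Lemma ps_idomain (K : fieldType) (a b : powser K) :
  a * b = 0 -> (a == 0) || (b == 0).
Proof.
move=> ab0; case: eqVneq => //= /ps_neq0_order [m [am Hm]].
apply: contraT => /ps_neq0_order [n [bn Hn]].
move/(congr1 (fun c => pscoef c (m + n))): ab0 => /=; rewrite if_same.
have lt_m : (m < (m + n).+1)%N by rewrite ltnS leq_addr.
rewrite (bigD1 (Ordinal lt_m)) //= addKn big1 ?addr0 => [/eqP|i].
  by rewrite mulf_eq0 (negPf am) (negPf bn).
rewrite -val_eqE /= neq_ltn => /orP[/Hm ->|lt_mi]; first by rewrite mul0r.
by rewrite [pscoef b _]Hn ?mulr0 // ltn_subLR ?ltn_add2r // -ltnS.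
Qed.

HB.instance Definition _ (K : fieldType) :=
  GRing.ComUnitRing_isIntegral.Build (powser K) (@ps_idomain K).

(* K((t)), as the field of fractions of K[[t]]. *)
Notation laurent K := {fraction (powser K)}.
Notation "x %:F" := (@FracField.tofrac _ x) (at level 1, format "x %:F").

Definition tvar (K : fieldType) : powser K :=
  PowSer (fun n => (n == 1%N)%:R).

(** * The t-adic valuation

   For W of finite dimension with basis indexed by I, an element of
   K((t)) (x) W is given by its coordinate family {ffun I -> K((t))}. *)

Definition in_t_pow (K : fieldType) (I : finType) (m : int)
    (w : {ffun I -> laurent K}) : Prop :=
  exists u : {ffun I -> powser K}, forall j, w j = (tvar K)%:F ^ m * (u j)%:F.

(* For w != 0 the largest m exists, so the default 0 of xget is not used. *)
Definition val_t (K : fieldType) (I : finType) (w : {ffun I -> laurent K}) :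
    \bar int :=
  if w == 0 then +oo%E
  else (xget 0 [set m : int | in_t_pow m w /\
                  forall k : int, in_t_pow k w -> k <= m]%classic)%:E%E.

Definition val_t_scalar (K : fieldType) (x : laurent K) : \bar int :=
  val_t [ffun _ : unit => x].

(** * Tensor products

   The tensor product over A of the free modules A^(n 0), ..., A^(n (d-1)),
   in coordinates with respect to the tensor product basis. *)

Notation mindex n := {dffun forall i, 'I_(n i)}.
Notation tensor A n := {ffun mindex n -> A}.

Definition pure_tensor (A : comNzRingType) (d : nat) (n : 'I_d -> nat)
    (x : forall i, 'cV[A]_(n i)) : tensor A n :=
  [ffun J : mindex n => \prod_i x i (J i) 0].

(* The action of g_0 (x) ... (x) g_(d-1), i.e. the Kronecker product of the
   matrices g_i; on pure tensors it is factorwise ([tensor_act_pure]). *)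
Definition tensor_act (A : comNzRingType) (d : nat) (n : 'I_d -> nat)
    (g : forall i, 'M[A]_(n i)) (w : tensor A n) : tensor A n :=
  [ffun J : mindex n => \sum_(L : mindex n) (\prod_i g i (J i) (L i)) * w L].

Lemma mindex_distr (A : comNzRingType) (d : nat) (n : 'I_d -> nat)
    (F : forall i, 'I_(n i) -> A) :
  \sum_(J : mindex n) \prod_i F i (J i) = \prod_i \sum_j F i j.
Proof.
pose T_ (i : 'I_d) : finType := 'I_(n i).
rewrite (reindex (@dffun_of_fprod _ T_)) /=; last first.
  exact/onW_bij/dffun_of_fprod_bij.
transitivity (\sum_(t : fprod T_) \prod_(i in 'I_d) [ffun j => F i j] (t i)).
  by apply: eq_bigr => t _; apply: eq_bigr => i _; rewrite !ffunE.
rewrite big_fprod -(bigA_distr_big_dep _ (fun i u => untag 0 [ffun j => F i j] u)).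
apply: eq_bigr => i _; rewrite -(big_tag (fun i => [ffun j => F i j])).
by apply: eq_bigr => j _; rewrite ffunE.
Qed.

Lemma tensor_act_pure (A : comNzRingType) (d : nat) (n : 'I_d -> nat)
    (g : forall i, 'M[A]_(n i)) (x : forall i, 'cV[A]_(n i)) :
  tensor_act g (pure_tensor x) = pure_tensor (fun i => g i *m x i).
Proof.
apply/ffunP => J; rewrite !ffunE.
under [RHS]eq_bigr => i _ do rewrite mxE.
rewrite -[RHS](mindex_distr (fun i j => g i (J i) j * x i j 0)).
by apply: eq_bigr => L _; rewrite ffunE big_split.
Qed.

Definition vdims (K : fieldType) (d : nat) (Vs : 'I_d -> vectType K) :
  'I_d -> nat := fun i => \dim {:Vs i}.

Definition vcoords (K : fieldType) (W : vectType K) (w : W) :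
  'cV[K]_(\dim {:W}) := \col_j coord (vbasis {:W}) j w.

(* V_0 (x) ... (x) V_(d-1) is [tensor K (vdims Vs)]: the map [vtens] is
   multilinear and sends the products of basis vectors to the standard basis
   ([vtens_basis]). *)
Definition vtens (K : fieldType) (d : nat) (Vs : 'I_d -> vectType K)
    (v : forall i, Vs i) : tensor K (vdims Vs) :=
  @pure_tensor K d (vdims Vs) (fun i => vcoords (v i)).

Lemma vtens_basis (K : fieldType) (d : nat) (Vs : 'I_d -> vectType K)
    (J : mindex (vdims Vs)) :
  vtens (fun i => (vbasis {:Vs i})`_(J i)) =
  [ffun L : mindex (vdims Vs) => (L == J)%:R].
Proof.
apply/ffunP => L; rewrite !ffunE.
under eq_bigr => i _ do
  rewrite mxE coord_free ?(basis_free (vbasisP _)) //.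
have [->|neq_LJ] := eqVneq L J; first by rewrite big1 // => i _; rewrite eqxx.
have [i neq_i] : exists i, L i != J i.
  apply/existsP; rewrite -negb_forall; apply: contra neq_LJ => /forallP H.
  by apply/eqP/ffunP => i; apply/eqP/H.
by rewrite (bigD1 i) //= eq_sym -val_eqE in neq_i *; rewrite (negPf neq_i) mul0r.
Qed.

Definition tensor_rank1 (K : fieldType) (d : nat) (Vs : 'I_d -> vectType K)
    (v : tensor K (vdims Vs)) : Prop :=
  v != 0 /\ exists vs : forall i, Vs i, v = vtens vs.

(** * The G-stable rank *)

(* Invertible over K((t)), not necessarily over K[[t]]. *)
Definition GLps (K : fieldType) (n : nat) (g : 'M[powser K]_n) : Prop :=
  map_mx (@FracField.tofrac (powser K)) g \in unitmx.

Definition Gps (K : fieldType) (d : nat) (n : 'I_d -> nat)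
    (g : forall i, 'M[powser K]_(n i)) : Prop :=
  forall i, GLps (g i).

(* v |-> 1 (x) v, from V to K((t)) (x) V. *)
Definition extend_scalars (K : fieldType) (I : finType) (v : {ffun I -> K}) :
    {ffun I -> laurent K} :=
  [ffun j => (ps_const (v j))%:F].

Definition G_act (K : fieldType) (d : nat) (n : 'I_d -> nat)
    (g : forall i, 'M[powser K]_(n i)) (w : tensor (laurent K) n) :
    tensor (laurent K) n :=
  tensor_act (fun i => map_mx (@FracField.tofrac (powser K)) (g i)) w.

(* The quotient is taken in \bar R, where x / +oo = 0 for finite x. *)
Definition mu (K : fieldType) (R : realType) (d : nat) (n : 'I_d -> nat)
    (alpha : 'I_d -> R) (g : forall i, 'M[powser K]_(n i)) (v : tensor K n) :
    \bar R :=
  ((\sum_(i < d) (alpha i)%:E *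
      er_map intr (val_t_scalar (\det (g i))%:F))
   / er_map intr (val_t (G_act g (extend_scalars v))))%E.

Definition G_stable_rank (K : fieldType) (R : realType) (d : nat)
    (n : 'I_d -> nat) (alpha : 'I_d -> R) (v : tensor K n) : \bar R :=
  ereal_inf [set mu alpha g v | g in
    [set g : forall i, 'M[powser K]_(n i) |
       Gps g /\ (0 < val_t (G_act g (extend_scalars v)))%E]]%classic.

(* Main.v *)
Require Import Defs.
From HB Require Import structures.
From mathcomp Require Import all_boot all_order all_algebra all_field.
From mathcomp Require Import all_classical all_reals ereal.
Set Implicit Arguments.
Unset Strict Implicit.
Unset Printing Implicit Defensive.
Import Order.TTheory GRing.Theory Num.Theory.
Local Open Scope ring_scope.

(** Write v = x_1 (x) ... (x) x_d with every x_i nonzero.  Everything rests on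
    writing a nonzero family of power series as t^m u with u(0) nonzero: then m
    is its valuation, and these factorisations multiply, because the constant
    coefficients do.  As g acts factorwise, the valuation of g v is the sum
    of the m_i, where g_i x_i = t^(m_i) u_i with u_i(0) <> 0.

    For the lower bound, let k_i be the valuation of det g_i.  The identity
    adj(g_i) (g_i x_i) = det(g_i) x_i shows that t^(m_i) divides det(g_i) x_i,
    and x_i has a nonzero constant entry, so m_i <= k_i ([GLps_factor]).  As
    the alpha_i are positive, the sum of the alpha_i k_i is at least the sum of
    the alpha_i m_i, which is at least (min alpha) times the sum of the m_i.

    For the upper bound, let i0 minimise alpha.  There are g_i with
    det g_i = t^(m_i) and g_i x_i = t^(m_i) u_i, where u_i(0) <> 0, for any
    prescribed exponents m_i ([det_tvarXM_exists]).  Taking m_i = 1 for i = i0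
    and m_i = 0 otherwise gives the quotient alpha_i0 / 1. *)

(** * Powers of t in K[[t]] *)

Lemma ps_const_is_zmod_morphism (K : fieldType) : zmod_morphism (@ps_const K).
Proof. by move=> a b; apply: psP => -[|n] //=; rewrite subr0. Qed.

Lemma ps_const_is_monoid_morphism (K : fieldType) :
  monoid_morphism (@ps_const K).
Proof.
split=> // a b; apply: psP => n /=.
rewrite big_ord_recl /= subn0 big1 ?addr0 => [|i _]; last by rewrite mul0r.
by case: n => [|n] //=; rewrite mulr0.
Qed.

HB.instance Definition _ (K : fieldType) :=
  GRing.isZmodMorphism.Build K (powser K) (@ps_const K)
    (@ps_const_is_zmod_morphism K).
HB.instance Definition _ (K : fieldType) :=
  GRing.isMonoidMorphism.Build K (powser K) (@ps_const K)
    (@ps_const_is_monoid_morphism K).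

Lemma pscoef0M (K : fieldType) (a b : powser K) :
  pscoef (a * b) 0 = pscoef a 0 * pscoef b 0.
Proof. by rewrite /= big_ord_recl big_ord0 addr0. Qed.

Lemma pscoef0_prod (K : fieldType) (I : finType) (F : I -> powser K) :
  pscoef (\prod_i F i) 0 = \prod_i pscoef (F i) 0.
Proof. exact: (big_morph (fun a => pscoef a 0) (@pscoef0M K)). Qed.

Lemma pscoef_tvarM (K : fieldType) (a : powser K) n :
  pscoef (tvar K * a) n = if n is k.+1 then pscoef a k else 0.
Proof.
rewrite /= big_ord_recl /= mul0r add0r.
case: n => [|n]; first by rewrite big_ord0.
rewrite big_ord_recl /= mul1r subSS subn0 big1 ?addr0 // => i _.
by rewrite mul0r.
Qed.

Lemma pscoef_tvarXM (K : fieldType) m (a : powser K) n :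
  pscoef (tvar K ^+ m * a) n = if (n < m)%N then 0 else pscoef a (n - m).
Proof.
elim: m n => [|m IHm] n; first by rewrite expr0 mul1r subn0.
by rewrite exprS -mulrA pscoef_tvarM; case: n => // n; rewrite IHm subSS ltnS.
Qed.

Lemma tvar_neq0 (K : fieldType) : tvar K != 0.
Proof.
by apply/eqP => /(congr1 (fun a => pscoef a 1)) /= /eqP; rewrite oner_eq0.
Qed.

Lemma pscoef0_neq0 (K : fieldType) (a : powser K) : pscoef a 0 != 0 -> a != 0.
Proof. by apply: contraNneq => ->. Qed.

(** A series with nonzero constant coefficient absorbs no power of t: compare
    the coefficients of t^n. *)
Lemma tvarXM_leq (K : fieldType) m n (a b : powser K) :
  pscoef a 0 != 0 -> tvar K ^+ n * a = tvar K ^+ m * b -> (m <= n)%N.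
Proof.
move=> a0 /(congr1 (fun c => pscoef c n)); rewrite !pscoef_tvarXM ltnn subnn.
by case: ltnP => // _ a0E; rewrite a0E eqxx in a0.
Qed.

(** The exponent m is the least order among the entries of w; u is w shifted
    down by m coefficients. *)
Lemma tvarXM_factor (K : fieldType) (I : finType) (w : I -> powser K) :
  (exists j, w j != 0) ->
  exists m (u : I -> powser K), (forall j, w j = tvar K ^+ m * u j) /\
    exists j, pscoef (u j) 0 != 0.
Proof.
case=> j0 /ps_neq0_order [n0 [wn0 _]].
have ex : exists n, [exists j, pscoef (w j) n != 0].
  by exists n0; apply/existsP; exists j0.
case: (ex_minnP ex) => m /existsP[j wjm] m_min.
exists m, (fun j => PowSer (fun n => pscoef (w j) (n + m))); split=> [i|].
  apply: psP => n; rewrite pscoef_tvarXM; case: ltnP => /= [lt_nm|le_mn].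
    apply/eqP; apply: contraTT lt_nm => win; rewrite -leqNgt.
    by apply: m_min; apply/existsP; exists i.
  by rewrite subnK.
by exists j.
Qed.

(** * Valuations of factored families *)

(** Computes [val_t] from a factorisation: t^m divides w, and no higher power
    does since that would contradict [tvarXM_leq] at an entry
    where u has a nonzero constant coefficient. *)
Lemma val_t_tvarXM (K : fieldType) (I : finType) (w : {ffun I -> laurent K})
    m (u : I -> powser K) :
  (forall j, w j = (tvar K ^+ m * u j)%:F) ->
  (exists j, pscoef (u j) 0 != 0) ->
  val_t w = (m%:Z)%:E%E.
Proof.
move=> wE [j uj0].
have in_m : in_t_pow m w.
  by exists [ffun j => u j] => i; rewrite ffunE wE tofracM tofracXn.
have max_m (k : int) : in_t_pow k w -> k <= m.
  case=> u' w'E; rewrite leNgt; apply/negP.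
  case: k w'E => [k|//] w'E; rewrite ltz_nat ltnNge => /negP; apply.
  apply: (@tvarXM_leq _ k m (u j) (u' j)) => //.
  by apply/eqP; rewrite -tofrac_eq -wE w'E tofracM tofracXn.
rewrite /val_t ifN; last first.
  apply/eqP => /ffunP/(_ j); rewrite wE ffunE => /eqP; apply/negP.
  by rewrite tofrac_eq0 mulf_neq0 ?expf_neq0 ?tvar_neq0 ?pscoef0_neq0.
congr (_%:E)%E; apply: xget_unique => // k [in_k max_k].
by apply/le_anti; rewrite max_m // max_k.
Qed.

Lemma val_t_scalar_tvarXM (K : fieldType) m (a : powser K) :
  pscoef a 0 != 0 -> val_t_scalar (tvar K ^+ m * a)%:F = (m%:Z)%:E%E.
Proof.
move=> a0; apply: (@val_t_tvarXM _ _ _ m (fun=> a)) => [j|].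
  by rewrite ffunE.
by exists tt.
Qed.

(** Pick in each factor an entry with nonzero constant coefficient: at this
    multi-index the product of the u i again has one. *)
Lemma val_t_pure_tensor (K : fieldType) (d : nat) (n : 'I_d -> nat)
    (m : 'I_d -> nat) (u : forall i, 'cV[powser K]_(n i)) :
  (forall i, exists j, pscoef (u i j 0) 0 != 0) ->
  val_t [ffun J => (pure_tensor (fun i => tvar K ^+ m i *: u i) J)%:F] =
  ((\sum_i m i)%N%:Z)%:E%E.
Proof.
move=> u0; apply: (@val_t_tvarXM _ _ _ _ (pure_tensor u)) => [J|].
  rewrite !ffunE; congr (_%:F); rewrite -prodrXr -big_split.
  by apply: eq_bigr => i _; rewrite mxE.
exists [ffun i => projT1 (cid (u0 i))]; rewrite ffunE pscoef0_prod.
by apply/prodf_neq0 => i _; rewrite ffunE; case: cid.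
Qed.

(** Lets all valuations be computed over K[[t]], where the constant coefficient
    is available, rather than over K((t)). *)
Lemma G_act_pure_tensor (K : fieldType) (d : nat) (n : 'I_d -> nat)
    (g : forall i, 'M[powser K]_(n i)) (x : forall i, 'cV[K]_(n i)) :
  G_act g (extend_scalars (pure_tensor x)) =
  [ffun J => (pure_tensor (fun i => g i *m map_mx (@ps_const K) (x i)) J)%:F].
Proof.
have -> : extend_scalars (pure_tensor x) = pure_tensor (fun i =>
    map_mx (@FracField.tofrac (powser K)) (map_mx (@ps_const K) (x i))).
  apply/ffunP => J; rewrite !ffunE !rmorph_prod.
  by apply: eq_bigr => i _; rewrite !mxE.
rewrite /G_act tensor_act_pure; apply/ffunP => J; rewrite !ffunE rmorph_prod.
by apply: eq_bigr => i _; rewrite -map_mxM mxE.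
Qed.

(** * One tensor factor *)

Lemma GLps_det (K : fieldType) n (g : 'M[powser K]_n) :
  GLps g <-> \det g != 0.
Proof. by rewrite /GLps unitmxE det_map_mx unitfE tofrac_eq0. Qed.

Lemma adj_mulmx (A : comNzRingType) n (g : 'M[A]_n) (x : 'cV[A]_n) :
  \adj g *m (g *m x) = \det g *: x.
Proof. by rewrite mulmxA mul_adj_mx mul_scalar_mx. Qed.

(** Here k is the valuation of det g and m that of g x.  Both det g and g x are
    nonzero, which gives the factorisations; m <= k because t^m divides
    adj(g) (g x) = det(g) x, which has valuation k at any nonzero entry of x. *)
Lemma GLps_factor (K : fieldType) n (g : 'M[powser K]_n) (x : 'cV[K]_n) :
  GLps g -> x != 0 ->
  exists (k m : nat) (a : powser K) (u : 'cV[powser K]_n),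
    [/\ \det g = tvar K ^+ k * a /\ pscoef a 0 != 0,
        g *m map_mx (@ps_const K) x = tvar K ^+ m *: u,
        exists j, pscoef (u j 0) 0 != 0 & (m <= k)%N].
Proof.
move=> /GLps_det dg0 /cV0Pn[j xj].
set X := map_mx _ x; have Xj : pscoef (X j 0) 0 != 0 by rewrite mxE.
have [k [a [dE [[] a0]]]] :=
  @tvarXM_factor K unit (fun=> \det g) (ex_intro _ tt dg0).
have [|m [u [uE [i ui]]]] := @tvarXM_factor K 'I_n (fun i => (g *m X) i 0).
  apply/cV0Pn/eqP => gX0; move: dg0.
  rewrite -(mulIr_eq0 _ (mulIf (pscoef0_neq0 Xj))).
  have := adj_mulmx g X; rewrite gX0 mulmx0 => /colP/(_ j).
  by rewrite mxE [in RHS]mxE => <-; rewrite eqxx.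
have gXE : g *m X = tvar K ^+ m *: \col_i u i.
  by apply/colP => l; rewrite uE !mxE.
exists k, m, (a tt), (\col_i u i); split=> //; first by exists i; rewrite mxE.
have := adj_mulmx g X; rewrite gXE -scalemxAr => /colP/(_ j).
rewrite mxE [in RHS]mxE (dE tt) -mulrA => /esym.
by apply: tvarXM_leq; rewrite pscoef0M mulf_neq0.
Qed.

(** With x_k a nonzero entry, g is the composite of the shear that clears all
    entries of x but the k-th with the scaling of the k-th coordinate by t^m. *)
Lemma det_tvarXM_exists (K : fieldType) n (x : 'cV[K]_n) (m : nat) :
  x != 0 ->
  exists (g : 'M[powser K]_n) (u : 'cV[powser K]_n),
    [/\ \det g = tvar K ^+ m,
        g *m map_mx (@ps_const K) x = tvar K ^+ m *: u &
        exists j, pscoef (u j 0) 0 != 0].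
Proof.
move=> /cV0Pn[k xk].
pose g : 'M[powser K]_n := \matrix_(i, j)
  if i == k then (j == k)%:R * tvar K ^+ m
  else (j == i)%:R - (j == k)%:R * ps_const (x i 0 / x k 0).
exists g, (ps_const (x k 0) *: delta_mx k 0); split.
  (* Row k of g is t^m e_k; deleting row and column k leaves the identity. *)
- rewrite (expand_det_row _ k) (bigD1 k) //= big1 ?addr0 => [|j /negPf jk].
    rewrite mxE !eqxx mul1r /cofactor exprD -expr2 sqrr_sign mul1r.
    rewrite (_ : row' _ _ = 1%:M) ?det1 ?mulr1 //; apply/matrixP => i j.
    rewrite !mxE ![_ == k]eq_sym !(negPf (neq_lift k _)) mul0r subr0.
    by rewrite (inj_eq lift_inj) eq_sym.
  by rewrite mxE eqxx jk mul0r mul0r.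
- apply/colP => i; rewrite !mxE eqxx andbT.
  have [->|ik] := eqVneq i k.
    rewrite (bigD1 k) //= big1 ?addr0 => [|j /negPf jk].
      by rewrite !mxE !eqxx mul1r mulr1.
    by rewrite !mxE eqxx jk !mul0r.
  rewrite !mulr0 (bigD1 i) //= (bigD1 k) 1?eq_sym //= big1 => [|j].
    rewrite !mxE (negPf ik) (eq_sym k) (negPf ik) !eqxx mul1r mul0r subr0 sub0r.
    by rewrite mul1r addr0 mulNr -rmorphM /= divfK // subrr.
  case/andP=> /negPf ji /negPf jk.
  by rewrite !mxE (negPf ik) ji jk mul0r subr0 mul0r.
- by exists k; rewrite !mxE !eqxx mulr1.
Qed.

(** * Rank one tensors *)

Lemma val_t_G_act (K : fieldType) (d : nat) (n : 'I_d -> nat)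
    (g : forall i, 'M[powser K]_(n i)) (x : forall i, 'cV[K]_(n i))
    (m : 'I_d -> nat) (u : forall i, 'cV[powser K]_(n i)) :
  (forall i, g i *m map_mx (@ps_const K) (x i) = tvar K ^+ m i *: u i) ->
  (forall i, exists j, pscoef (u i j 0) 0 != 0) ->
  val_t (G_act g (extend_scalars (pure_tensor x))) = ((\sum_i m i)%N%:Z)%:E%E.
Proof.
move=> gxE u0; rewrite G_act_pure_tensor -(val_t_pure_tensor _ u0).
congr val_t; apply/ffunP => J; rewrite !ffunE; congr (_%:F).
by apply: eq_bigr => i _; rewrite gxE.
Qed.

(** Turns the quotient of extended reals into one of reals; positivity of the
    denominator is what excludes the value +oo of 1 / 0. *)
Lemma mu_pure_tensor (K : fieldType) (R : realType) (d : nat) (n : 'I_d -> nat)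
    (alpha : 'I_d -> R)
    (g : forall i, 'M[powser K]_(n i)) (x : forall i, 'cV[K]_(n i))
    (k m : 'I_d -> nat) (a : 'I_d -> powser K)
    (u : forall i, 'cV[powser K]_(n i)) :
  (forall i, \det (g i) = tvar K ^+ k i * a i /\ pscoef (a i) 0 != 0) ->
  (forall i, g i *m map_mx (@ps_const K) (x i) = tvar K ^+ m i *: u i) ->
  (forall i, exists j, pscoef (u i j 0) 0 != 0) ->
  (0 < \sum_i m i)%N ->
  mu alpha g (pure_tensor x) =
  ((\sum_i alpha i * (k i)%:R) / (\sum_i m i)%N%:R)%:E.
Proof.
move=> dE gxE u0 m_gt0; rewrite /mu (val_t_G_act gxE u0) /=.
rewrite (eq_bigr (fun i => (alpha i * (k i)%:R)%:E)) => [|i _].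
  by rewrite sumEFin -[_%:~R]/(_%:R) inver pnatr_eq0 eqn0Ngt m_gt0.
by have [-> ai0] := dE i; rewrite val_t_scalar_tvarXM.
Qed.

(** Choice for dependent families, needed because the g_i are matrices of
    different sizes. *)
Lemma dependent_choice (I : Type) (T : I -> Type) (P : forall i, T i -> Prop) :
  (forall i, exists y, P i y) -> exists f : forall i, T i, forall i, P i (f i).
Proof. by move=> H; exists (fun i => projT1 (cid (H i))) => i; case: cid. Qed.

Theorem corollary3p3 (K : fieldType) (hK : perfect_field K) (R : realType)
    (d : nat) (hd : (0 < d)%N) (Vs : 'I_d -> vectType K)
    (alpha : 'I_d -> R) (halpha : forall i, 0 < alpha i)
    (v : tensor K (vdims Vs)) (hv : tensor_rank1 v) :
  G_stable_rank alpha v = (\big[mine/+oo]_(i < d) (alpha i)%:E)%E.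
Proof.
case: hv => v0 [vs vE].
pose x i : 'cV[K]_(vdims Vs i) := vcoords (vs i).
have {}vE : v = pure_tensor x by [].
have x0 i : x i != 0.
  apply: contraNneq v0 => xi0; apply/eqP/ffunP => J.
  by rewrite vE !ffunE (bigD1 i) //= xi0 mxE mul0r.
rewrite {}vE {v v0}.
have [i0 _ minE] := @eq_bigmin _ _ _ +oo%E (Ordinal hd) xpredT
  (fun i => (alpha i)%:E) isT (fun i _ => leey _).
have alpha_min i : alpha i0 <= alpha i.
  by rewrite -lee_fin -minE; apply: bigmin_le.
rewrite minE; apply/le_anti/andP; split.
  (* The witness divides the i0-th factor, and no other, by one power of t. *)
  pose m i := nat_of_bool (i == i0).
  have [g /dependent_choice[u guP]] :=
    dependent_choice (fun i => det_tvarXM_exists (m i) (x0 i)).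
  have dE i : \det (g i) = tvar K ^+ m i * 1 /\ pscoef (1 : powser K) 0 != 0.
    by have [-> _ _] := guP i; rewrite mulr1 oner_eq0.
  have gxE i : g i *m map_mx (@ps_const K) (x i) = tvar K ^+ m i *: u i.
    by have [] := guP i.
  have u0 i : exists j, pscoef (u i j 0) 0 != 0 by have [] := guP i.
  have sum_m : (\sum_i m i = 1)%N.
    by rewrite (bigD1 i0) //= big1 /m ?eqxx // => i /negPf ->.
  rewrite -[leRHS](_ : mu alpha g (pure_tensor x) = _); last first.
    rewrite (mu_pure_tensor _ dE gxE u0) sum_m //.
    rewrite divr1 (bigD1 i0) //= big1 /m ?eqxx ?mulr1 ?addr0 // => i /negPf ->.
    by rewrite mulr0.
  apply: ereal_inf_lbound; exists g => //; split=> [i|].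
    by apply/GLps_det; have [-> _] := dE i; rewrite mulr1 expf_neq0 ?tvar_neq0.
  by rewrite (val_t_G_act gxE u0) sum_m.
apply: le_ereal_inf_tmp => _ [g [gGL val_gt0] <-].
have [k /dependent_choice[m /dependent_choice[a /dependent_choice[u P]]]] :=
  dependent_choice (fun i => GLps_factor (gGL i) (x0 i)).
have dE i : \det (g i) = tvar K ^+ k i * a i /\ pscoef (a i) 0 != 0.
  by have [] := P i.
have gxE i : g i *m map_mx (@ps_const K) (x i) = tvar K ^+ m i *: u i.
  by have [] := P i.
have u0 i : exists j, pscoef (u i j 0) 0 != 0 by have [] := P i.
have m_gt0 : (0 < \sum_i m i)%N.
  by move: val_gt0; rewrite (val_t_G_act gxE u0) lte_fin ltz_nat.
rewrite (mu_pure_tensor _ dE gxE u0 m_gt0) lee_fin.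
rewrite ler_pdivlMr ?ltr0n // natr_sum mulr_sumr; apply: ler_sum => i _.
have [_ _ _ le_mk] := P i.
apply: ler_pM; rewrite ?ler0n ?ler_nat //; exact: ltW.
Qed.
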